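(* Let $\underline{Q} : \underline{\mathrm{QYBA}} \to \underline{\mathrm{CYBA}}[[\hbar]]$ be a prop morphism over $\mathbb{K}[[\hbar]]$ such that $(\underline{Q}\ \mathrm{mod}\ \hbar)\circ \underline{\mathrm{SC}}$ is the identity of $\underline{\mathrm{CYBA}}$. Then $\underline{Q}$ is an isomorphism of props.
   Context: Conventions. $\mathbb{K}$ is a field of characteristic zero, $\hbar$ a formal variable, $R$ is $\mathbb{K}$ or $\mathbb{K}[[\hbar]]$. All $\mathbb{K}[[\hbar]]$-modules are quotients of topologically free modules (modules $V[[\hbar]]$) by closed submodules; direct sums and tensor products are taken in this (completed) category and maps are continuous. A prop $\underline{P}$ over $R$ is the collection of $R$-modules $\underline{P}(n,m)=\mathrm{Hom}(O^{\otimes n},O^{\otimes m})$, $n,m\ge 0$, of a strict symmetric monoidal $R$-linear category with objects $O^{\otimes n}$, together with composition $\underline P(n,m)\otimes\underline P(m,p)\to\underline P(n,p)$, $f\otimes g\mapsto g\circ f$, the tensor product $\otimes$, and the maps $\mathbb{Q}\mathfrak{S}_n\to\underline P(n,n)$. Elements of $\underline P(n,m)$ have bidegree $(n,m)$. Morphisms, ideals, quotients, free props, and props defined by generators and relations are the obvious ones. $\underline P[[\hbar]](p,q)=\underline P(p,q)[[\hbar]]$. The permutation $(i_1\ldots i_k)$ sends $a$ to $i_a$ (moves the $a$-th tensor factor to position $i_a$). If $x_i\in\underline P(0,n_i)$ and $I_1,\dots,I_p$ are ordered sets partitioning $[1,\sum n_i]$ with $|I_i|=n_i$, then $x_1^{I_1}\cdots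 x_p^{I_p}=\sigma\circ(x_1\otimes\cdots\otimes x_p)$ with $\sigma$ the permutation placing the components of $x_i$ in the positions $I_i$ in order. $\underline{\mathrm{CYBA}}$ is the prop over $\mathbb{K}$ with generators $\eta,m,r$ of bidegrees $(0,1),(2,1),(0,2)$ and relations $m\circ(\eta\otimes\mathrm{id})=m\circ(\mathrm{id}\otimes\eta)=\mathrm{id}$, $m\circ(m\otimes\mathrm{id})=m\circ(\mathrm{id}\otimes m)$ and $$(\mu\otimes\mathrm{id}\otimes\mathrm{id})(r^{1,3}r^{2,4})+(\mathrm{id}\otimes\mu\otimes\mathrm{id})(r^{1,2}r^{3,4})+(\mathrm{id}\otimes\mathrm{id}\otimes\mu)(r^{1,3}r^{2,4})=0,\qquad \mu=m-m\circ(21).$$ $\underline{\mathrm{QYBA}}$ is the quotient of the free prop over $\mathbb{K}[[\hbar]]$ generated by $\eta,m,\rho$ of bidegrees $(0,1),(2,1),(0,2)$ by the $\hbar$-adically closed ideal generated by the same relations between $\eta$ and $m$ and by $$(\mu\otimes\mathrm{id}\otimes\mathrm{id})(\rho^{1,3}\rho^{2,4})+(\mathrm{id}\otimes\mu\otimes\mathrm{id})(\rho^{1,2}\rho^{3,4})+(\mathrm{id}\otimes\mathrm{id}\otimes\mu)(\rho^{1,3}\rho^{2,4})+\hbar(m\otimes m\otimes m)(\rho^{1,3}\rho^{2,5}\rho^{4,6}-\rho^{3,5}\rho^{1,6}\rho^{2,4})=0 .$$ $\underline{\mathrm{SC}}:\underline{\mathrm{CYBA}}\to\underline{\mathrm{QYBA}}/(\hbar)$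 is the prop morphism taking $\eta,m,r$ to the classes of $\eta,m,\rho$. (Morphisms $\underline Q$ as in the claim exist by work of Etingof and Kazhdan.) *)

(* Defs.v *)
From HB Require Import structures.
From mathcomp Require Import all_boot all_algebra all_fingroup.
From mathcomp Require Import generic_quotient ring_quotient.
From mathcomp Require Import boolp classical_sets functions.

Set Implicit Arguments.
Unset Strict Implicit.
Unset Printing Implicit Defensive.

Import GRing.Theory.
Local Open Scope ring_scope.
Local Open Scope quotient_scope.

Section CauchyProduct.
Variables U V W : zmodType.

Definition biadditive (b : U -> V -> W) : Prop :=
  (forall x, {morph b x : y z / y + z}) /\ (forall y, {morph b^~ y : x z / x + z}).

Definition conv (b : U -> V -> W) (u : nat -> U) (v : nat -> V) : nat -> W :=
  fun n => \sum_(i < n.+1) b (u i) (v (n - i)%N).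

Variable b : U -> V -> W.
Hypothesis hb : biadditive b.

Lemma biadd0r x : b x 0 = 0.
Proof. by case: hb => br _; apply: (addrI (b x 0)); rewrite -br !addr0. Qed.

Lemma biadd0l y : b 0 y = 0.
Proof. by case: hb => _ bl; apply: (addrI (b 0 y)); rewrite -bl !addr0. Qed.

Lemma biadd_sumr x (I : Type) (r : seq I) F :
  b x (\sum_(i <- r) F i) = \sum_(i <- r) b x (F i).
Proof. by apply: big_morph; [case: hb | exact: biadd0r]. Qed.

Lemma biadd_suml y (I : Type) (r : seq I) F :
  b (\sum_(i <- r) F i) y = \sum_(i <- r) b (F i) y.
Proof.
apply: (big_morph (b^~ y)); last exact: biadd0l.
by case: hb => _; apply.
Qed.

Lemma biaddMb x y (c d : bool) : b (x *+ c) (y *+ d) = b x y *+ c *+ d.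
Proof. by case: c d => [] [] //=; rewrite ?mulr1n ?mulr0n ?(biadd0r, biadd0l). Qed.

Lemma conv_box u v n N : (n <= N)%N ->
  conv b u v n =
  \sum_(i < N.+1) \sum_(j < N.+1) b (u i) (v j) *+ (i + j == n)%N.
Proof.
move=> le_nN.
have nN : (n < N.+1)%N by [].
rewrite /conv (big_ord_widen _ (fun i => b (u i) (v (n - i)%N)) nN).
rewrite big_mkcond; apply: eq_bigr => i _.
case: ifP => [lein | /negbT]; last first.
  rewrite -leqNgt => ltni; rewrite big1 // => j _.
  by rewrite gtn_eqF ?mulr0n // (leq_trans ltni (leq_addr j i)).
have nij : (n - i < N.+1)%N by rewrite (leq_ltn_trans (leq_subr _ _)).
rewrite (bigD1 (Ordinal nij)) //= subnKC // eqxx mulr1n big1 ?addr0 //.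
move=> j; rewrite -val_eqE /= => ne.
case: eqP => // e; case/negP: ne.
by rewrite -e addKn.
Qed.

Lemma convDl u u' v : conv b (u + u') v = conv b u v + conv b u' v.
Proof.
apply/funext => n; rewrite [RHS]/GRing.add /= /conv -big_split.
by apply: eq_bigr => i _; case: hb => _ ->.
Qed.

Lemma convDr u v v' : conv b u (v + v') = conv b u v + conv b u v'.
Proof.
apply/funext => n; rewrite [RHS]/GRing.add /= /conv -big_split.
by apply: eq_bigr => i _; case: hb => ->.
Qed.

End CauchyProduct.

Section ConvTheory.

Definition const_ser (V : zmodType) (x : V) : nat -> V :=
  fun n => if n is 0 then x else 0.

Lemma conv_constl (U V W : zmodType) (b : U -> V -> W) x v :
  biadditive b -> conv b (const_ser x) v = fun n => b x (v n).
Proof.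
move=> hb; apply/funext => n; rewrite /conv big_ord_recl /= subn0 big1 ?addr0 //.
by move=> i _; rewrite biadd0l.
Qed.

Lemma conv_flip (U V W : zmodType) (b : U -> V -> W) u v :
  conv b u v = conv (fun y x => b x y) v u.
Proof.
apply/funext => n; rewrite (conv_box _ _ _ (leqnn n)) (conv_box _ _ _ (leqnn n)).
rewrite exchange_big; apply: eq_bigr => j _; apply: eq_bigr => i _ /=.
by rewrite addnC.
Qed.

Lemma conv_constr (U V W : zmodType) (b : U -> V -> W) u y :
  biadditive b -> conv b u (const_ser y) = fun n => b (u n) y.
Proof.
move=> hb; have hb' : biadditive (fun y x => b x y) by case: hb.
by rewrite conv_flip // conv_constl.
Qed.

Lemma conv_consts (U V W : zmodType) (b : U -> V -> W) x y :
  biadditive b -> conv b (const_ser x) (const_ser y) = const_ser (b x y).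
Proof.
move=> hb; rewrite conv_constl //; apply/funext => -[|n] //=.
by rewrite biadd0r.
Qed.

Let collapse (V : zmodType) (x : V) (s t n : nat) :
  \sum_(p < n.+1) x *+ (s == p) *+ (p + t == n)%N = x *+ (s + t == n)%N.
Proof.
have [lesn | ltns] := ltnP s n.+1.
  rewrite (bigD1 (Ordinal lesn)) //= eqxx mulr1n big1 ?addr0 // => p.
  by rewrite -val_eqE /= eq_sym => /negbTE->; rewrite mulr0n mul0rn.
rewrite big1 => [|p _]; first by rewrite gtn_eqF ?mulr0n // (leq_trans ltns) ?leq_addr.
by rewrite gtn_eqF ?mulr0n ?mul0rn // (leq_trans _ ltns).
Qed.

Lemma conv_assoc (U V W X Y Z : zmodType)
    (b1 : X -> W -> Z) (b2 : U -> V -> X) (b3 : U -> Y -> Z) (b4 : V -> W -> Y) :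
  biadditive b1 -> biadditive b2 -> biadditive b3 -> biadditive b4 ->
  (forall x y z, b1 (b2 x y) z = b3 x (b4 y z)) ->
  forall u v w, conv b1 (conv b2 u v) w = conv b3 u (conv b4 v w).
Proof.
move=> h1 h2 h3 h4 h u v w; apply/funext => n.
rewrite (conv_box _ _ _ (leqnn n)) (conv_box _ _ _ (leqnn n)).
transitivity (\sum_(i < n.+1) \sum_(j < n.+1) \sum_(k < n.+1)
   b3 (u i) (b4 (v j) (w k)) *+ (i + (j + k) == n)%N).
  transitivity (\sum_(p < n.+1) \sum_(k < n.+1) \sum_(i < n.+1) \sum_(j < n.+1)
     b3 (u i) (b4 (v j) (w k)) *+ (i + j == p)%N *+ (p + k == n)%N).
    apply: eq_bigr => p _; apply: eq_bigr => k _.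
    rewrite (conv_box _ _ _ (leq_ord p)) (biadd_suml h1) -sumrMnl.
    apply: eq_bigr => i _; rewrite (biadd_suml h1) -sumrMnl.
    apply: eq_bigr => j _.
    by rewrite -h -[w k]mulr1n -/(true : nat) (biaddMb h1) mulr1n.
  under eq_bigr do rewrite exchange_big /=.
  rewrite exchange_big /=; apply: eq_bigr => i _.
  under eq_bigr do rewrite exchange_big /=.
  rewrite exchange_big /=; apply: eq_bigr => j _.
  rewrite exchange_big /=; apply: eq_bigr => k _.
  by rewrite collapse addnA.
apply: eq_bigr => i _; apply/esym.
transitivity (\sum_(q < n.+1) \sum_(j < n.+1) \sum_(k < n.+1)
     b3 (u i) (b4 (v j) (w k)) *+ (j + k == q)%N *+ (q + i == n)%N).
  apply: eq_bigr => q _.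
  rewrite (conv_box _ _ _ (leq_ord q)) (biadd_sumr h3) -sumrMnl.
  apply: eq_bigr => j _; rewrite (biadd_sumr h3) -sumrMnl.
  apply: eq_bigr => k _.
  by rewrite -[u i]mulr1n -/(true : nat) (biaddMb h3) mulr1n [(i + q)%N]addnC.
rewrite exchange_big /=; apply: eq_bigr => j _.
rewrite exchange_big /=; apply: eq_bigr => k _.
by rewrite collapse [(i + _)%N]addnC.
Qed.

Lemma conv_interchange (U U' V V' X X' Y Y' Z : zmodType)
    (b : X -> X' -> Z) (c : U -> V -> X) (c' : U' -> V' -> X')
    (d : Y -> Y' -> Z) (e : U -> U' -> Y) (e' : V -> V' -> Y') :
  biadditive b -> biadditive c -> biadditive c' ->
  biadditive d -> biadditive e -> biadditive e' ->
  (forall x y x' y', b (c x y) (c' x' y') = d (e x x') (e' y y')) ->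
  forall u v u' v',
  conv b (conv c u v) (conv c' u' v') = conv d (conv e u u') (conv e' v v').
Proof.
have expand (U1 U2 V1 V2 X1 X2 Z1 : zmodType) (f : X1 -> X2 -> Z1)
   (g : U1 -> V1 -> X1) (g' : U2 -> V2 -> X2) u v u' v' n :
   biadditive f -> biadditive g -> biadditive g' ->
   conv f (conv g u v) (conv g' u' v') n =
   \sum_(i < n.+1) \sum_(j < n.+1) \sum_(k < n.+1) \sum_(l < n.+1)
     f (g (u i) (v j)) (g' (u' k) (v' l)) *+ (i + j + (k + l) == n)%N.
  move=> hf hg hg'; rewrite (conv_box _ _ _ (leqnn n)).
  transitivity (\sum_(p < n.+1) \sum_(q < n.+1) \sum_(i < n.+1) \sum_(j < n.+1)
      \sum_(k < n.+1) \sum_(l < n.+1) f (g (u i) (v j)) (g' (u' k) (v' l))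
      *+ (i + j == p)%N *+ (k + l == q)%N *+ (p + q == n)%N).
    apply: eq_bigr => p _; apply: eq_bigr => q _.
    rewrite (conv_box _ _ _ (leq_ord p)) (conv_box _ _ _ (leq_ord q)).
    rewrite (biadd_suml hf) -sumrMnl; apply: eq_bigr => i _.
    rewrite (biadd_suml hf) -sumrMnl; apply: eq_bigr => j _.
    rewrite (biadd_sumr hf) -sumrMnl; apply: eq_bigr => k _.
    rewrite (biadd_sumr hf) -sumrMnl; apply: eq_bigr => l _.
    by rewrite (biaddMb hf).
  under eq_bigr do rewrite exchange_big /=.
  rewrite exchange_big /=; apply: eq_bigr => i _.
  under eq_bigr do rewrite exchange_big /=.
  rewrite exchange_big /=; apply: eq_bigr => j _.
  under eq_bigr do rewrite exchange_big /=.
  rewrite exchange_big /=; apply: eq_bigr => k _.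
  under eq_bigr do rewrite exchange_big /=.
  rewrite exchange_big /=; apply: eq_bigr => l _.
  rewrite exchange_big /=.
  rewrite (addnC (i + j)%N) -collapse; apply: eq_bigr => q _.
  rewrite [(q + _)%N]addnC -collapse; apply: eq_bigr => p _.
  by congr (_ *+ _); rewrite mulrnAC.
move=> hb hc hc' hd he he' h u v u' v'; apply/funext => n.
rewrite (expand _ _ _ _ _ _ _ _ _ _ _ _ _ _ _ hb hc hc').
rewrite (expand _ _ _ _ _ _ _ _ _ _ _ _ _ _ _ hd he he').
apply: eq_bigr => i _; rewrite exchange_big /=; apply: eq_bigr => j _.
apply: eq_bigr => k _; apply: eq_bigr => l _.
by rewrite h addnACA.
Qed.

End ConvTheory.

(* K[[h]] is the type nat -> K of coefficient sequences, V[[h]] is nat -> V.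
   The product and the action are Cauchy products, not the pointwise operations
   that nat -> K carries by default, hence the aliases. *)
Definition fps (K : comNzRingType) : Type := nat -> K.

Section FpsRing.
Variable K : comNzRingType.
Implicit Types a b c : fps K.

HB.instance Definition _ := GRing.Zmodule.copy (fps K) (nat -> K).

Definition fps_mul a b : fps K := conv *%R a b.

Lemma mul_biadd : biadditive ( *%R : K -> K -> K).
Proof. by split=> [x y z | y x z]; rewrite (mulrDr, mulrDl). Qed.
Let hb := mul_biadd.

Fact fps_mulA : associative fps_mul.
Proof. by move=> a b c; apply/esym/conv_assoc => // *; rewrite mulrA. Qed.

Fact fps_mulC : commutative fps_mul.
Proof.
move=> a b; rewrite /fps_mul conv_flip; congr (conv _ b a).
by apply/funext => x; apply/funext => y; rewrite mulrC.
Qed.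

Fact fps_mul1 : left_id (const_ser 1 : fps K) fps_mul.
Proof. by move=> a; rewrite /fps_mul conv_constl //; apply/funext => n; rewrite mul1r. Qed.

Fact fps_mulDl : left_distributive fps_mul +%R.
Proof. by move=> a b c; apply: convDl. Qed.

Fact fps_oner_neq0 : (const_ser 1 : fps K) != 0.
Proof.
by apply/eqP => /(congr1 (fun a : fps K => a 0%N)) /eqP; rewrite oner_eq0.
Qed.

HB.instance Definition _ := GRing.Zmodule_isComNzRing.Build (fps K)
  fps_mulA fps_mulC fps_mul1 fps_mulDl fps_oner_neq0.

Definition hvar : fps K := fun n => (n == 1)%:R.

Definition fps_const (x : K) : fps K := const_ser x.

Fact fps_const_zmod : zmod_morphism fps_const.
Proof. by move=> x y; apply/funext => -[|n] //=; apply/esym/subr0. Qed.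

Fact fps_const_monoid : monoid_morphism fps_const.
Proof. by split=> // x y; apply/esym/conv_consts. Qed.

HB.instance Definition _ :=
  GRing.isZmodMorphism.Build K (fps K) fps_const fps_const_zmod.
HB.instance Definition _ :=
  GRing.isMonoidMorphism.Build K (fps K) fps_const fps_const_monoid.

End FpsRing.

Definition series (K : comNzRingType) (V : lmodType K) : Type := nat -> V.

Section SeriesModule.
Variables (K : comNzRingType) (V : lmodType K).

HB.instance Definition _ := GRing.Zmodule.copy (series V) (nat -> V).

Definition series_scale (a : fps K) (v : series V) : series V := conv *:%R a v.

Lemma scale_biadd : biadditive ( *:%R : K -> V -> V).
Proof. by split=> [x y z | y x z]; rewrite (scalerDr, scalerDl). Qed.
Let hb := scale_biadd.

Fact series_scaleA a b v :
  series_scale a (series_scale b v) = series_scale (a * b) v.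
Proof.
apply/esym/conv_assoc => //; first exact: mul_biadd.
by move=> *; rewrite scalerA.
Qed.

Fact series_scale1 : left_id 1 series_scale.
Proof.
by move=> v; rewrite /series_scale conv_constl //; apply/funext => n; rewrite scale1r.
Qed.

Fact series_scaleDr : right_distributive series_scale +%R.
Proof. by move=> a u v; apply: convDr. Qed.

Fact series_scaleDl v : {morph series_scale^~ v : a b / a + b}.
Proof. by move=> a b; apply: convDl. Qed.

HB.instance Definition _ := GRing.Zmodule_isLmodule.Build (fps K) (series V)
  series_scaleA series_scale1 series_scaleDr series_scaleDl.

End SeriesModule.

Definition restr_mod (R S : pzRingType) (phi : {rmorphism R -> S}) (V : lmodType S) :
  Type := V.

Section RestrictScalars.
Variables (R S : pzRingType) (phi : {rmorphism R -> S}) (V : lmodType S).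
Local Notation rV := (restr_mod phi V).

HB.instance Definition _ := GRing.Zmodule.copy rV V.

Definition restr_scale (a : R) (v : rV) : rV := (phi a *: (v : V) : V).

Fact restr_scaleA a b v : restr_scale a (restr_scale b v) = restr_scale (a * b) v.
Proof. by rewrite /restr_scale scalerA rmorphM. Qed.

Fact restr_scale1 : left_id 1 restr_scale.
Proof. by move=> v; rewrite /restr_scale rmorph1 scale1r. Qed.

Fact restr_scaleDr : right_distributive restr_scale +%R.
Proof. by move=> a u v; apply: scalerDr. Qed.

Fact restr_scaleDl v : {morph restr_scale^~ v : a b / a + b}.
Proof. by move=> a b; rewrite /restr_scale rmorphD scalerDl. Qed.

HB.instance Definition _ := GRing.Zmodule_isLmodule.Build R rV
  restr_scaleA restr_scale1 restr_scaleDr restr_scaleDl.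

End RestrictScalars.

Record submod (R : pzRingType) (V : lmodType R) := Submod {
  submod_mem :> V -> Prop;
  submod0 : submod_mem 0;
  submodP : forall a x y, submod_mem x -> submod_mem y -> submod_mem (a *: x + y)
}.

Definition submod_pred (R : pzRingType) (V : lmodType R) (I : submod V) : V -> bool :=
  fun x => `[< I x >].

Section QuotientModule.
Variables (R : pzRingType) (V : lmodType R) (I : submod V).

Fact submod_pred_closed : zmod_closed (submod_pred I).
Proof.
split=> [|x y /asboolP Ix /asboolP Iy]; apply/asboolP; first exact: submod0.
by rewrite addrC -scaleN1r; apply: submodP.
Qed.

HB.instance Definition _ := GRing.isZmodClosed.Build V (submod_pred I) submod_pred_closed.

Definition quot_mod : Type := Quotient.quot (GRing.ZmodClosed.clone V (submod_pred I) _).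
HB.instance Definition _ := GRing.Zmodule.on quot_mod.
HB.instance Definition _ := ZmodQuotient.on quot_mod.

Definition cls (x : V) : quot_mod := \pi_quot_mod x.

Lemma clsK (q : quot_mod) : cls (repr q) = q. Proof. exact: reprK. Qed.

Lemma cls_eq x y : cls x = cls y <-> I (x - y).
Proof.
split=> [/eqP|Ixy].
  by rewrite -[_ == _]Quotient.idealrBE => /asboolP.
by apply/eqP; rewrite -[_ == _]Quotient.idealrBE; apply/asboolP.
Qed.

Lemma repr_cls x : I (repr (cls x) - x).
Proof. by apply/cls_eq; rewrite clsK. Qed.

Lemma clsD x y : cls (x + y) = cls x + cls y.
Proof. exact: raddfD. Qed.

Definition quot_scale (a : R) (q : quot_mod) : quot_mod := cls (a *: repr q).

Lemma quot_scaleE a x : quot_scale a (cls x) = cls (a *: x).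
Proof.
apply/cls_eq; rewrite -scalerBr -[_ *: _]addr0.
by apply: submodP; [exact: repr_cls | exact: submod0].
Qed.

Fact quot_scaleA a b q : quot_scale a (quot_scale b q) = quot_scale (a * b) q.
Proof. by rewrite -[q]clsK !quot_scaleE scalerA. Qed.

Fact quot_scale1 : left_id 1 quot_scale.
Proof. by move=> q; rewrite -[q]clsK quot_scaleE scale1r. Qed.

Fact quot_scaleDr : right_distributive quot_scale +%R.
Proof.
by move=> a p q; rewrite -[p]clsK -[q]clsK -clsD !quot_scaleE scalerDr clsD.
Qed.

Fact quot_scaleDl q : {morph quot_scale^~ q : a b / a + b}.
Proof. by move=> a b; rewrite -[q]clsK !quot_scaleE scalerDl clsD. Qed.

HB.instance Definition _ := GRing.Zmodule_isLmodule.Build R quot_mod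
  quot_scaleA quot_scale1 quot_scaleDr quot_scaleDl.

Fact cls_linear : linear cls.
Proof. by move=> a x y; rewrite clsD -quot_scaleE. Qed.
HB.instance Definition _ := GRing.isLinear.Build R V quot_mod *:%R cls cls_linear.

Lemma cls_eq0 x : cls x = 0 <-> I x.
Proof. by rewrite -[0](raddf0 cls) cls_eq subr0. Qed.

End QuotientModule.

Section QuotientLift.
Variables (R : pzRingType) (V W : lmodType R) (I : submod V).
Variables (f : {linear V -> W}) (fI : forall x, I x -> f x = 0).

Definition quot_lift (q : quot_mod I) : W := f (repr q).

Lemma quot_liftE x : quot_lift (cls I x) = f x.
Proof. by apply/eqP; rewrite -subr_eq0 /quot_lift -(linearB f) fI //; apply: repr_cls. Qed.

Fact quot_lift_linear : linear quot_lift.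
Proof.
by move=> a p q; rewrite -[p]clsK -[q]clsK -linearP !quot_liftE linearP.
Qed.
End QuotientLift.

(* Factor i of the source goes to position s i, i.e. perm [:: i_1; ..; i_k]
   sends a to i_a. *)
Section BlockPermutations.

Definition dsum_fun n n' (s : 'S_n) (t : 'S_n') (i : 'I_(n + n')) : 'I_(n + n') :=
  unsplit (match fintype.split i with inl a => inl (s a) | inr b => inr (t b) end).

Fact dsum_inj n n' s t : injective (@dsum_fun n n' s t).
Proof.
move=> i j /(can_inj (@unsplitK _ _)) e; apply: (can_inj (@splitK _ _)).
by case: (fintype.split i) (fintype.split j) e => a [] b // [] /perm_inj->.
Qed.

Definition dsum_perm n n' (s : 'S_n) (t : 'S_n') : 'S_(n + n') :=
  perm (@dsum_inj n n' s t).

Definition swap_fun n n' (i : 'I_(n + n')) : 'I_(n + n') :=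
  cast_ord (addnC n' n)
    (unsplit (match fintype.split i with inl a => inr a | inr b => inl b end)).

Fact swap_inj n n' : injective (@swap_fun n n').
Proof.
move=> i j /cast_ord_inj /(can_inj (@unsplitK _ _)) e.
apply: (can_inj (@splitK _ _)).
by case: (fintype.split i) (fintype.split j) e => a [] b // [] ->.
Qed.

(* The first n factors jump over the last n' ones. *)
Definition swap_perm n n' : 'S_(n + n') := perm (@swap_inj n n').

End BlockPermutations.

Definition hcast (T : nat -> nat -> Type) n m n' m' (en : n = n') (em : m = m')
    (x : T n m) : T n' m' :=
  ecast i (T i m') en (ecast j (T n j) em x).

(* A strict symmetric monoidal R-linear category with objects the powers of O:
   [hom n m] is Hom(O^n, O^m), [pcomp g f] is g o f. The coherence isomorphisms
   being identities, the tensor axioms hold up to transport along the equalities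
   of natural numbers. (s * t)%g is "s, then t" in MathComp. *)
Record propOver (R : comNzRingType) := PropOver {
  hom :> nat -> nat -> lmodType R;
  pid : forall n, hom n n;
  pcomp : forall n m p, hom m p -> hom n m -> hom n p;
  ptens : forall n m n' m', hom n m -> hom n' m' -> hom (n + n') (m + m');
  pperm : forall n, 'S_n -> hom n n;
  pcomp_linear_l : forall n m p (f : hom n m), linear (fun g : hom m p => pcomp g f);
  pcomp_linear_r : forall n m p (g : hom m p), linear (fun f : hom n m => pcomp g f);
  pcompA : forall n m p q (h : hom p q) (g : hom m p) (f : hom n m),
    pcomp (pcomp h g) f = pcomp h (pcomp g f);
  pcomp1l : forall n m (f : hom n m), pcomp (pid m) f = f;
  pcomp1r : forall n m (f : hom n m), pcomp f (pid n) = f;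
  ptens_linear_l : forall n m n' m' (f' : hom n' m'),
    linear (fun f : hom n m => ptens f f');
  ptens_linear_r : forall n m n' m' (f : hom n m),
    linear (fun f' : hom n' m' => ptens f f');
  ptens1 : forall n n', ptens (pid n) (pid n') = pid (n + n');
  ptens_comp : forall n m p n' m' p'
      (g : hom m p) (f : hom n m) (g' : hom m' p') (f' : hom n' m'),
    ptens (pcomp g f) (pcomp g' f') = pcomp (ptens g g') (ptens f f');
  ptensA : forall n m n' m' n'' m'' (f : hom n m) (f' : hom n' m') (f'' : hom n'' m''),
    hcast (T := hom) (addnA n n' n'') (addnA m m' m'') (ptens f (ptens f' f''))
    = ptens (ptens f f') f'';
  ptens0l : forall n m (f : hom n m), ptens (pid 0) f = f;
  ptens0r : forall n m (f : hom n m),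
    hcast (T := hom) (addn0 n) (addn0 m) (ptens f (pid 0)) = f;
  pperm1 : forall n, pperm 1%g = pid n;
  ppermM : forall n (s t : 'S_n), pperm (s * t)%g = pcomp (pperm t) (pperm s);
  pperm_tens : forall n n' (s : 'S_n) (t : 'S_n'),
    ptens (pperm s) (pperm t) = pperm (dsum_perm s t);
  pperm_swap : forall n m n' m' (f : hom n m) (f' : hom n' m'),
    pcomp (pperm (swap_perm m m')) (ptens f f')
    = pcomp (hcast (T := hom) (addnC n' n) (addnC m' m) (ptens f' f)) (pperm (swap_perm n n'))
}.

Arguments pid {R} P n : rename.
Arguments pcomp {R P n m p} g f : rename.
Arguments ptens {R P n m n' m'} f f' : rename.
Arguments pperm {R} P {n} s : rename.

Notation "g \oP f" := (pcomp g f) (at level 40, left associativity).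
Notation "f \xP g" := (ptens f g) (at level 38, left associativity).

Lemma linear_add (R : pzRingType) (U V : lmodType R) (f : U -> V) :
  linear f -> {morph f : x y / x + y}.
Proof. by move=> fl x y; rewrite -[x]scale1r fl !scale1r. Qed.

Lemma linear_scale (R : pzRingType) (U V : lmodType R) (f : U -> V) :
  linear f -> forall a, {morph f : x / a *: x}.
Proof.
move=> fl a x; have f0 : f 0 = 0.
  by apply: (addrI (f 0)); rewrite -(linear_add fl) !addr0.
by rewrite -[a *: x]addr0 fl f0 addr0.
Qed.

Section PropTheory.
Variables (R : comNzRingType) (P : propOver R).

Lemma pcomp_biadd n m p : biadditive (@pcomp R P n m p).
Proof.
by split=> x; apply: linear_add; [exact: pcomp_linear_r | exact: pcomp_linear_l].
Qed.

Lemma ptens_biadd n m n' m' : biadditive (@ptens R P n m n' m').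
Proof.
by split=> x; apply: linear_add; [exact: ptens_linear_r | exact: ptens_linear_l].
Qed.

Lemma pcompZl n m p a (g : P m p) (f : P n m) : (a *: g) \oP f = a *: (g \oP f).
Proof. exact: (linear_scale (pcomp_linear_l f)). Qed.

Lemma pcompZr n m p a (g : P m p) (f : P n m) : g \oP (a *: f) = a *: (g \oP f).
Proof. exact: (linear_scale (pcomp_linear_r g)). Qed.

Lemma ptensZl n m n' m' a (f : P n m) (f' : P n' m') :
  (a *: f) \xP f' = a *: (f \xP f').
Proof. exact: (linear_scale (ptens_linear_l f')). Qed.

Lemma ptensZr n m n' m' a (f : P n m) (f' : P n' m') :
  f \xP (a *: f') = a *: (f \xP f').
Proof. exact: (linear_scale (ptens_linear_r f)). Qed.

End PropTheory.

(* Over fps K no continuity clause is needed, for linear maps and for the bilinear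
   operations of propOver alike: they are automatically h-adically continuous. *)
Record prop_mor (R : comNzRingType) (P P' : propOver R) := PropMor {
  mor_fun :> forall n m, P n m -> P' n m;
  mor_linear : forall n m, linear (@mor_fun n m);
  mor_id : forall n, mor_fun (pid P n) = pid P' n;
  mor_comp : forall n m p (g : P m p) (f : P n m),
    mor_fun (g \oP f) = mor_fun g \oP mor_fun f;
  mor_tens : forall n m n' m' (f : P n m) (f' : P n' m'),
    mor_fun (f \xP f') = mor_fun f \xP mor_fun f';
  mor_perm : forall n (s : 'S_n), mor_fun (pperm P s) = pperm P' s
}.

Definition mor_eq (R : comNzRingType) (P P' : propOver R) (F G : prop_mor P P') :
  Prop := forall n m (x : P n m), F n m x = G n m x.

Definition idmor (R : comNzRingType) (P : propOver R) : prop_mor P P :=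
  @PropMor R P P (fun _ _ x => x) (fun _ _ _ _ _ => erefl) (fun=> erefl)
    (fun _ _ _ _ _ => erefl) (fun _ _ _ _ _ _ => erefl) (fun _ _ => erefl).

Definition compmor (R : comNzRingType) (P P' P'' : propOver R)
  (G : prop_mor P' P'') (F : prop_mor P P') : prop_mor P P''.
Proof.
exists (fun n m x => G n m (F n m x)).
- by move=> n m a x y; rewrite !mor_linear.
- by move=> n; rewrite !mor_id.
- by move=> *; rewrite !mor_comp.
- by move=> *; rewrite !mor_tens.
- by move=> *; rewrite !mor_perm.
Defined.

Definition prop_iso (R : comNzRingType) (P P' : propOver R) (F : prop_mor P P') :
  Prop :=
  exists G : prop_mor P' P,
    mor_eq (compmor G F) (idmor P) /\ mor_eq (compmor F G) (idmor P').

Section MorLinear.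
Variables (R : comNzRingType) (P P' : propOver R) (F : prop_mor P P') (n m : nat).
HB.instance Definition _ :=
  GRing.isLinear.Build R (P n m) (P' n m) *:%R (@mor_fun _ _ _ F n m)
    (@mor_linear _ _ _ F n m).
End MorLinear.

Section MorTheory.
Variables (R : comNzRingType) (P P' : propOver R) (F : prop_mor P P').

Lemma morD n m (x y : P n m) :
  F n m (x + y) = F n m x + F n m y.
Proof. exact: (linear_add (@mor_linear _ _ _ F n m)). Qed.

Lemma morZ n m a (x : P n m) :
  F n m (a *: x) = a *: F n m x.
Proof. exact: (linear_scale (@mor_linear _ _ _ F n m)). Qed.

Lemma mor0 n m :
  F n m 0 = 0.
Proof. exact: (raddf0 (F n m)). Qed.

Lemma morB n m (x y : P n m) :
  F n m (x - y) = F n m x - F n m y.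
Proof. exact: (raddfB (F n m)). Qed.

End MorTheory.

Record prop_ideal (R : comNzRingType) (P : propOver R) := PropIdeal {
  idl :> forall n m, submod (P n m);
  idl_compl : forall n m p (g : P m p) (f : P n m), idl n m f -> idl n p (g \oP f);
  idl_compr : forall n m p (g : P m p) (f : P n m), idl m p g -> idl n p (g \oP f);
  idl_tensl : forall n m n' m' (f : P n m) (f' : P n' m'),
    idl n m f -> idl (n + n')%N (m + m')%N (f \xP f');
  idl_tensr : forall n m n' m' (f : P n m) (f' : P n' m'),
    idl n' m' f' -> idl (n + n')%N (m + m')%N (f \xP f')
}.

Section QuotientProp.
Variables (R : comNzRingType) (P : propOver R) (I : prop_ideal P).

Definition quot_hom n m : lmodType R := quot_mod (I n m).
Local Notation "[ x ]" := (cls (I _ _) x : quot_hom _ _).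

Definition quot_comp n m p (g : quot_hom m p) (f : quot_hom n m) : quot_hom n p :=
  [repr g \oP repr f].

Definition quot_tens n m n' m' (f : quot_hom n m) (f' : quot_hom n' m') :
  quot_hom (n + n') (m + m') := [repr f \xP repr f'].

Lemma quot_compE n m p (g : P m p) (f : P n m) : quot_comp [g] [f] = [g \oP f].
Proof.
have [br bl] := pcomp_biadd P n m p.
apply/cls_eq.
set g' := repr _; set f' := repr _.
have -> : g' \oP f' - g \oP f = (g' - g) \oP f' + g \oP (f' - f).
  rewrite bl br -!scaleN1r pcompZl pcompZr !scaleN1r.
  by rewrite addrA subrK.
rewrite -[_ \oP f']scale1r; apply: submodP.
  by apply: idl_compr; apply: repr_cls.
by apply: idl_compl; apply: repr_cls.
Qed.

Lemma quot_tensE n m n' m' (f : P n m) (f' : P n' m') :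
  quot_tens [f] [f'] = [f \xP f'].
Proof.
have [br bl] := ptens_biadd P n m n' m'.
apply/cls_eq.
set g := repr _; set g' := repr _.
have -> : g \xP g' - f \xP f' = (g - f) \xP g' + f \xP (g' - f').
  rewrite bl br -!scaleN1r ptensZl ptensZr !scaleN1r.
  by rewrite addrA subrK.
rewrite -[_ \xP g']scale1r; apply: submodP.
  by apply: idl_tensl; apply: repr_cls.
by apply: idl_tensr; apply: repr_cls.
Qed.

Lemma quot_hcast n m n' m' (en : n = n') (em : m = m') (x : P n m) :
  hcast (T := quot_hom) en em [x] = [hcast (T := fun i j => P i j) en em x].
Proof. by case: _ / en; case: _ / em. Qed.

Lemma quot_homP n m (q : quot_hom n m) : exists x, q = [x].
Proof. by exists (repr q); rewrite clsK. Qed.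

Definition quot_prop : propOver R.
Proof.
exists quot_hom (fun n => [pid P n]) quot_comp quot_tens (fun n s => [pperm P s]).
- move=> n m p f a g g'.
  have [[{}f ->] [{}g ->] [{}g' ->]] := And3 (quot_homP f) (quot_homP g) (quot_homP g').
  by rewrite -linearP !quot_compE (pcomp_linear_l f) linearP.
- move=> n m p g a f f'.
  have [[{}f ->] [{}g ->] [{}f' ->]] := And3 (quot_homP f) (quot_homP g) (quot_homP f').
  by rewrite -linearP !quot_compE (pcomp_linear_r g) linearP.
- move=> n m p q h g f.
  have [[{}f ->] [{}g ->] [{}h ->]] := And3 (quot_homP f) (quot_homP g) (quot_homP h).
  by rewrite (quot_compE h g) (quot_compE g f) !quot_compE pcompA.
- by move=> n m f; have [{}f ->] := quot_homP f; rewrite quot_compE pcomp1l.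
- by move=> n m f; have [{}f ->] := quot_homP f; rewrite quot_compE pcomp1r.
- move=> n m n' m' f a g g'.
  have [[{}f ->] [{}g ->] [{}g' ->]] := And3 (quot_homP f) (quot_homP g) (quot_homP g').
  by rewrite -linearP !quot_tensE (ptens_linear_l f) linearP.
- move=> n m n' m' g a f f'.
  have [[{}f ->] [{}g ->] [{}f' ->]] := And3 (quot_homP f) (quot_homP g) (quot_homP f').
  by rewrite -linearP !quot_tensE (ptens_linear_r g) linearP.
- by move=> n n'; rewrite quot_tensE ptens1.
- move=> n m p n' m' p' g f g' f'.
  have [[{}f ->] [{}g ->]] := conj (quot_homP f) (quot_homP g).
  have [[{}f' ->] [{}g' ->]] := conj (quot_homP f') (quot_homP g').
  rewrite (quot_compE g f) (quot_compE g' f') (quot_tensE g g') (quot_tensE f f').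
  by rewrite quot_tensE quot_compE ptens_comp.
- move=> n m n' m' n'' m'' h g f.
  have [[{}f ->] [{}g ->] [{}h ->]] := And3 (quot_homP f) (quot_homP g) (quot_homP h).
  rewrite (quot_tensE g f) (quot_tensE h g) !quot_tensE quot_hcast.
  by rewrite ptensA.
- by move=> n m f; have [{}f ->] := quot_homP f; rewrite quot_tensE ptens0l.
- by move=> n m f; have [{}f ->] := quot_homP f; rewrite quot_tensE quot_hcast ptens0r.
- by move=> n; rewrite pperm1.
- by move=> n s t; rewrite quot_compE ppermM.
- by move=> n n' s t; rewrite quot_tensE pperm_tens.
- move=> n m n' m' f g.
  have [[{}f ->] [{}g ->]] := conj (quot_homP f) (quot_homP g).
  rewrite (quot_tensE f g) (quot_tensE g f) quot_hcast !quot_compE.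
  by rewrite pperm_swap.
Defined.

Definition quot_proj : prop_mor P quot_prop.
Proof.
exists (fun n m (x : P n m) => [x] : quot_prop n m) => //.
- by move=> n m a x y; apply: linearP.
- by move=> n m p g f; rewrite -quot_compE.
- by move=> n m n' m' f f'; rewrite -quot_tensE.
Defined.

Definition quot_prop_lift (P' : propOver R) (F : prop_mor P P')
  (FI : forall n m (x : P n m), I n m x -> F n m x = 0) : prop_mor quot_prop P'.
Proof.
exists (fun n m => quot_lift (I := I n m) (F n m)).
- by move=> n m; apply: quot_lift_linear (FI n m).
- by move=> n; rewrite -(mor_id F); apply: (quot_liftE (FI n n)).
- move=> n m p g f.
  have [[{}f ->] [{}g ->]] := conj (quot_homP f) (quot_homP g).
  by rewrite [_ \oP _]quot_compE !(quot_liftE (FI _ _)) /= mor_comp.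
- move=> n m n' m' g f.
  have [[{}f ->] [{}g ->]] := conj (quot_homP f) (quot_homP g).
  by rewrite [_ \xP _]quot_tensE !(quot_liftE (FI _ _)) /= mor_tens.
- by move=> n s; rewrite -(mor_perm F); apply: (quot_liftE (FI n n)).
Defined.

Lemma quot_prop_liftE (P' : propOver R) (F : prop_mor P P') FI n m (x : P n m) :
  @quot_prop_lift P' F FI n m (quot_proj n m x) = F n m x.
Proof. exact: (quot_liftE (FI n m)). Qed.

End QuotientProp.

Section GeneratedIdeal.
Variables (R : comNzRingType) (P : propOver R).
Variable (admissible : prop_ideal P -> Prop).
Variable (rel : forall n m, P n m -> Prop).

Definition contains (I : prop_ideal P) : Prop :=
  forall n m (x : P n m), rel x -> I n m x.

Definition gen_mem n m (x : P n m) : Prop :=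
  forall I : prop_ideal P, admissible I -> contains I -> I n m x.

Definition gen_submod n m : submod (P n m).
Proof.
exists (@gen_mem n m) => [I aI cI | a x y Ix Iy I aI cI]; first exact: submod0.
by apply: submodP; [apply: Ix | apply: Iy].
Defined.

Definition gen_ideal_among : prop_ideal P.
Proof.
exists gen_submod => [n m p g f If|n m p g f Ig|n m n' m' f f' If|n m n' m' f f' If'] I aI cI.
- by apply: idl_compl; apply: If.
- by apply: idl_compr; apply: Ig.
- by apply: idl_tensl; apply: If.
- by apply: idl_tensr; apply: If'.
Defined.

Lemma gen_ideal_contains : contains gen_ideal_among.
Proof. by move=> n m x rx I _; apply. Qed.

End GeneratedIdeal.

Definition gen_ideal (R : comNzRingType) (P : propOver R)
    (rel : forall n m, P n m -> Prop) : prop_ideal P :=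
  gen_ideal_among (fun=> True) rel.

Section Kernel.
Variables (R : comNzRingType) (P P' : propOver R) (F : prop_mor P P').

Definition ker_submod n m : submod (P n m).
Proof.
exists (fun x => F n m x = 0); first exact: (raddf0 (F n m)).
by move=> a x y x0 y0; rewrite (mor_linear F) x0 y0 scaler0 addr0.
Defined.

Definition ker_ideal : prop_ideal P.
Proof.
exists ker_submod => [n m p g f f0|n m p g f g0|n m n' m' f f' f0|n m n' m' f f' f0] /=.
- rewrite mor_comp f0; exact: (biadd0r (pcomp_biadd _ _ _ _)).
- rewrite mor_comp g0; exact: (biadd0l (pcomp_biadd _ _ _ _)).
- rewrite mor_tens f0; exact: (biadd0l (ptens_biadd _ _ _ _ _)).
- rewrite mor_tens f0; exact: (biadd0r (ptens_biadd _ _ _ _ _)).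
Defined.

Lemma gen_ideal_ker (rel : forall n m, P n m -> Prop) :
  (forall n m (x : P n m), rel n m x -> F n m x = 0) ->
  forall n m (x : P n m), gen_ideal rel n m x -> F n m x = 0.
Proof. by move=> F0 n m x /(_ ker_ideal I F0). Qed.

End Kernel.

Definition hadic_closed (K : comNzRingType) (P : propOver (fps K))
    (I : prop_ideal P) : Prop :=
  forall n m (x : P n m),
    (forall N, exists2 y, I n m y & exists z : P n m, x - y = hvar K ^+ N *: z) ->
    I n m x.

Definition closed_gen_ideal (K : comNzRingType) (P : propOver (fps K))
    (rel : forall n m, P n m -> Prop) : prop_ideal P :=
  gen_ideal_among (@hadic_closed K P) rel.

Section FreeProp.
Variables (R : comNzRingType) (G : Type) (src tgt : G -> nat).

Inductive term : nat -> nat -> Type :=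
| Tgen (g : G) : term (src g) (tgt g)
| Tid n : term n n
| Tperm n (s : 'S_n) : term n n
| Tcomp n m p : term m p -> term n m -> term n p
| Ttens n m n' m' : term n m -> term n' m' -> term (n + n') (m + m')
| Tzero n m : term n m
| Tadd n m : term n m -> term n m -> term n m
| Tscale n m : R -> term n m -> term n m.

Arguments Tzero {n m}.

(* The smallest congruence satisfying the axioms of propOver. *)
Inductive teq : forall n m, term n m -> term n m -> Prop :=
| Erefl n m (x : term n m) : teq x x
| Esym n m (x y : term n m) : teq x y -> teq y x
| Etrans n m (x y z : term n m) : teq x y -> teq y z -> teq x z
| Ecomp n m p (g g' : term m p) (f f' : term n m) :
    teq g g' -> teq f f' -> teq (Tcomp g f) (Tcomp g' f')
| Etens n m n' m' (f g : term n m) (f' g' : term n' m') :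
    teq f g -> teq f' g' -> teq (Ttens f f') (Ttens g g')
| Eadd n m (x x' y y' : term n m) :
    teq x x' -> teq y y' -> teq (Tadd x y) (Tadd x' y')
| Escale n m a (x x' : term n m) : teq x x' -> teq (Tscale a x) (Tscale a x')
| EaddA n m (x y z : term n m) : teq (Tadd x (Tadd y z)) (Tadd (Tadd x y) z)
| EaddC n m (x y : term n m) : teq (Tadd x y) (Tadd y x)
| Eadd0 n m (x : term n m) : teq (Tadd Tzero x) x
| EaddN n m (x : term n m) : teq (Tadd (Tscale (-1) x) x) Tzero
| EscaleA n m a b (x : term n m) : teq (Tscale a (Tscale b x)) (Tscale (a * b) x)
| Escale1 n m (x : term n m) : teq (Tscale 1 x) x
| EscaleDr n m a (x y : term n m) :
    teq (Tscale a (Tadd x y)) (Tadd (Tscale a x) (Tscale a y))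
| EscaleDl n m a b (x : term n m) :
    teq (Tscale (a + b) x) (Tadd (Tscale a x) (Tscale b x))
| Ecomp_linl n m p a (g g' : term m p) (f : term n m) :
    teq (Tcomp (Tadd (Tscale a g) g') f) (Tadd (Tscale a (Tcomp g f)) (Tcomp g' f))
| Ecomp_linr n m p a (g : term m p) (f f' : term n m) :
    teq (Tcomp g (Tadd (Tscale a f) f')) (Tadd (Tscale a (Tcomp g f)) (Tcomp g f'))
| EcompA n m p q (h : term p q) (g : term m p) (f : term n m) :
    teq (Tcomp (Tcomp h g) f) (Tcomp h (Tcomp g f))
| Ecomp1l n m (f : term n m) : teq (Tcomp (Tid m) f) f
| Ecomp1r n m (f : term n m) : teq (Tcomp f (Tid n)) f
| Etens_linl n m n' m' a (f g : term n m) (f' : term n' m') :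
    teq (Ttens (Tadd (Tscale a f) g) f') (Tadd (Tscale a (Ttens f f')) (Ttens g f'))
| Etens_linr n m n' m' a (f : term n m) (f' g' : term n' m') :
    teq (Ttens f (Tadd (Tscale a f') g')) (Tadd (Tscale a (Ttens f f')) (Ttens f g'))
| Etens1 n n' : teq (Ttens (Tid n) (Tid n')) (Tid (n + n'))
| Etens_comp n m p n' m' p'
    (g : term m p) (f : term n m) (g' : term m' p') (f' : term n' m') :
    teq (Ttens (Tcomp g f) (Tcomp g' f')) (Tcomp (Ttens g g') (Ttens f f'))
| EtensA n m n' m' n'' m'' (f : term n m) (f' : term n' m') (f'' : term n'' m'') :
    teq (hcast (T := term) (addnA n n' n'') (addnA m m' m'') (Ttens f (Ttens f' f'')))
        (Ttens (Ttens f f') f'')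
| Etens0l n m (f : term n m) : teq (Ttens (Tid 0) f) f
| Etens0r n m (f : term n m) :
    teq (hcast (T := term) (addn0 n) (addn0 m) (Ttens f (Tid 0))) f
| Eperm1 n : teq (Tperm (1%g : 'S_n)) (Tid n)
| EpermM n (s t : 'S_n) : teq (Tperm (s * t)%g) (Tcomp (Tperm t) (Tperm s))
| Eperm_tens n n' (s : 'S_n) (t : 'S_n') :
    teq (Ttens (Tperm s) (Tperm t)) (Tperm (dsum_perm s t))
| Eperm_swap n m n' m' (f : term n m) (f' : term n' m') :
    teq (Tcomp (Tperm (swap_perm m m')) (Ttens f f'))
        (Tcomp (hcast (T := term) (addnC n' n) (addnC m' m) (Ttens f' f))
               (Tperm (swap_perm n n'))).

HB.instance Definition _ n m := gen_eqMixin (term n m).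
HB.instance Definition _ n m := gen_choiceMixin (term n m).

Definition teqb n m (x y : term n m) : bool := `[< teq x y >].

Fact teqb_equiv n m : equiv_class_of (@teqb n m).
Proof.
split=> [x | x y | y x z]; first exact/asboolP/Erefl.
  by apply/asboolP/asboolP => /Esym.
by move=> /asboolP xy /asboolP yz; apply/asboolP/(Etrans xy).
Qed.

Canonical teqb_equivRel n m := EquivRelPack (teqb_equiv n m).

Section FreeHom.
Variables n m : nat.

Definition free_hom : Type := {eq_quot (@teqb n m)}.
HB.instance Definition _ := Choice.on free_hom.

Definition tcls (x : term n m) : free_hom := \pi_({eq_quot (@teqb n m)}) x.
Definition trepr (q : free_hom) : term n m := repr (q : {eq_quot (@teqb n m)}).

Lemma treprK q : tcls (trepr q) = q. Proof. exact: reprK. Qed.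

Lemma tcls_eq x y : tcls x = tcls y <-> teq x y.
Proof.
by split=> [/eqmodP/asboolP | xy]; last by apply/eqmodP/asboolP.
Qed.

Lemma trepr_cls x : teq (trepr (tcls x)) x.
Proof. by apply/tcls_eq; rewrite treprK. Qed.

Lemma free_homP (q : free_hom) : exists x, q = tcls x.
Proof. by exists (trepr q); rewrite treprK. Qed.

Definition free_add (p q : free_hom) : free_hom := tcls (Tadd (trepr p) (trepr q)).
Definition free_scale a (q : free_hom) : free_hom := tcls (Tscale a (trepr q)).

Lemma free_addE x y : free_add (tcls x) (tcls y) = tcls (Tadd x y).
Proof. by apply/tcls_eq/Eadd; apply: trepr_cls. Qed.

Lemma free_scaleE a x : free_scale a (tcls x) = tcls (Tscale a x).
Proof. by apply/tcls_eq/Escale; apply: trepr_cls. Qed.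

Fact free_addA : associative free_add.
Proof.
move=> p q r.
have [[{}p ->] [{}q ->] [{}r ->]] := And3 (free_homP p) (free_homP q) (free_homP r).
rewrite (free_addE q r) (free_addE p q) !free_addE; exact/tcls_eq/EaddA.
Qed.

Fact free_addC : commutative free_add.
Proof.
move=> p q; have [[{}p ->] [{}q ->]] := conj (free_homP p) (free_homP q).
rewrite !free_addE; exact/tcls_eq/EaddC.
Qed.

Fact free_add0 : left_id (tcls Tzero) free_add.
Proof.
move=> p; have [{}p ->] := free_homP p; rewrite free_addE; exact/tcls_eq/Eadd0.
Qed.

Fact free_addN : left_inverse (tcls Tzero) (free_scale (-1)) free_add.
Proof.
move=> p; have [{}p ->] := free_homP p.
rewrite free_scaleE free_addE; exact/tcls_eq/EaddN.
Qed.

HB.instance Definition _ :=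
  GRing.isZmodule.Build free_hom free_addA free_addC free_add0 free_addN.

Fact free_scaleA a b q : free_scale a (free_scale b q) = free_scale (a * b) q.
Proof.
have [{}q ->] := free_homP q.
rewrite (free_scaleE b) !free_scaleE; exact/tcls_eq/EscaleA.
Qed.

Fact free_scale1 : left_id 1 free_scale.
Proof.
move=> q; have [{}q ->] := free_homP q; rewrite free_scaleE; exact/tcls_eq/Escale1.
Qed.

Fact free_scaleDr : right_distributive free_scale +%R.
Proof.
move=> a p q; have [[{}p ->] [{}q ->]] := conj (free_homP p) (free_homP q).
rewrite (free_scaleE a p) (free_scaleE a q) [_ + _]free_addE free_scaleE.
rewrite [RHS]free_addE; exact/tcls_eq/EscaleDr.
Qed.

Fact free_scaleDl q : {morph free_scale^~ q : a b / a + b}.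
Proof.
move=> a b; have [{}q ->] := free_homP q.
rewrite !free_scaleE [RHS]free_addE; exact/tcls_eq/EscaleDl.
Qed.

HB.instance Definition _ := GRing.Zmodule_isLmodule.Build R free_hom
  free_scaleA free_scale1 free_scaleDr free_scaleDl.

Lemma tclsP a x y : a *: tcls x + tcls y = tcls (Tadd (Tscale a x) y).
Proof.
by rewrite [a *: _]free_scaleE [_ + _]free_addE.
Qed.

End FreeHom.

Definition free_comp n m p (g : free_hom m p) (f : free_hom n m) : free_hom n p :=
  tcls (Tcomp (trepr g) (trepr f)).
Definition free_tens n m n' m' (f : free_hom n m) (f' : free_hom n' m') :
  free_hom (n + n') (m + m') := tcls (Ttens (trepr f) (trepr f')).

Lemma free_compE n m p (g : term m p) (f : term n m) :
  free_comp (tcls g) (tcls f) = tcls (Tcomp g f).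
Proof. by apply/tcls_eq/Ecomp; apply: trepr_cls. Qed.

Lemma free_tensE n m n' m' (f : term n m) (f' : term n' m') :
  free_tens (tcls f) (tcls f') = tcls (Ttens f f').
Proof. by apply/tcls_eq/Etens; apply: trepr_cls. Qed.

Lemma tcls_hcast n m n' m' (en : n = n') (em : m = m') (x : term n m) :
  hcast (T := free_hom) en em (tcls x) = tcls (hcast (T := term) en em x).
Proof. by case: _ / en; case: _ / em. Qed.

Definition free_prop : propOver R.
Proof.
exists (fun n m => free_hom n m) (fun n => tcls (Tid n)) free_comp free_tens
  (fun n s => tcls (Tperm s)).
- move=> n m p f a g g'.
  have [[{}f ->] [{}g ->] [{}g' ->]] := And3 (free_homP f) (free_homP g) (free_homP g').
  rewrite tclsP (free_compE _ f) (free_compE g) (free_compE g') tclsP.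
  exact/tcls_eq/Ecomp_linl.
- move=> n m p g a f f'.
  have [[{}f ->] [{}g ->] [{}f' ->]] := And3 (free_homP f) (free_homP g) (free_homP f').
  rewrite tclsP (free_compE g) (free_compE g f) (free_compE g f') tclsP.
  exact/tcls_eq/Ecomp_linr.
- move=> n m p q h g f.
  have [[{}f ->] [{}g ->] [{}h ->]] := And3 (free_homP f) (free_homP g) (free_homP h).
  rewrite (free_compE h g) (free_compE g f) !free_compE; exact/tcls_eq/EcompA.
- move=> n m f; have [{}f ->] := free_homP f; rewrite free_compE.
  exact/tcls_eq/Ecomp1l.
- move=> n m f; have [{}f ->] := free_homP f; rewrite free_compE.
  exact/tcls_eq/Ecomp1r.
- move=> n m n' m' f a g g'.
  have [[{}f ->] [{}g ->] [{}g' ->]] := And3 (free_homP f) (free_homP g) (free_homP g').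
  rewrite tclsP (free_tensE _ f) (free_tensE g) (free_tensE g') tclsP.
  exact/tcls_eq/Etens_linl.
- move=> n m n' m' g a f f'.
  have [[{}f ->] [{}g ->] [{}f' ->]] := And3 (free_homP f) (free_homP g) (free_homP f').
  rewrite tclsP (free_tensE g) (free_tensE g f) (free_tensE g f') tclsP.
  exact/tcls_eq/Etens_linr.
- by move=> n n'; rewrite free_tensE; exact/tcls_eq/Etens1.
- move=> n m p n' m' p' g f g' f'.
  have [[{}f ->] [{}g ->]] := conj (free_homP f) (free_homP g).
  have [[{}f' ->] [{}g' ->]] := conj (free_homP f') (free_homP g').
  rewrite (free_compE g f) (free_compE g' f') (free_tensE g g') (free_tensE f f').
  rewrite free_tensE free_compE; exact/tcls_eq/Etens_comp.
- move=> n m n' m' n'' m'' h g f.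
  have [[{}f ->] [{}g ->] [{}h ->]] := And3 (free_homP f) (free_homP g) (free_homP h).
  rewrite (free_tensE g f) (free_tensE h g) !free_tensE tcls_hcast.
  exact/tcls_eq/EtensA.
- move=> n m f; have [{}f ->] := free_homP f; rewrite free_tensE.
  exact/tcls_eq/Etens0l.
- move=> n m f; have [{}f ->] := free_homP f; rewrite free_tensE tcls_hcast.
  exact/tcls_eq/Etens0r.
- by move=> n; exact/tcls_eq/Eperm1.
- by move=> n s t; rewrite free_compE; exact/tcls_eq/EpermM.
- by move=> n n' s t; rewrite free_tensE; exact/tcls_eq/Eperm_tens.
- move=> n m n' m' f g.
  have [[{}f ->] [{}g ->]] := conj (free_homP f) (free_homP g).
  rewrite (free_tensE f g) (free_tensE g f) tcls_hcast !free_compE.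
  exact/tcls_eq/Eperm_swap.
Defined.

Definition free_gen (g : G) : free_prop (src g) (tgt g) := tcls (Tgen g).

(* The universal property, see also free_lift_uniq. *)
Section FreeLift.
Variables (P : propOver R) (img : forall g, P (src g) (tgt g)).

Fixpoint teval n m (x : term n m) : P n m :=
  match x with
  | Tgen g => img g
  | Tid n => pid P n
  | Tperm n s => pperm P s
  | Tcomp n m p g f => teval g \oP teval f
  | Ttens n m n' m' f f' => teval f \xP teval f'
  | Tzero n m => 0
  | Tadd n m x y => teval x + teval y
  | Tscale n m a x => a *: teval x
  end.

Lemma teval_hcast n m n' m' (en : n = n') (em : m = m') (x : term n m) :
  teval (hcast (T := term) en em x) = hcast (T := fun i j => P i j) en em (teval x).
Proof. by case: _ / en; case: _ / em. Qed.

Lemma teval_teq n m (x y : term n m) : teq x y -> teval x = teval y.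
Proof.
elim=> {n m x y} //=; rewrite ?teval_hcast.
- by move=> n m x y z _ -> _ ->.
- by move=> n m p g g' f f' _ -> _ ->.
- by move=> n m n' m' f g f' g' _ -> _ ->.
- by move=> n m x x' y y' _ -> _ ->.
- by move=> n m a x x' _ ->.
- by move=> *; rewrite addrA.
- by move=> *; rewrite addrC.
- by move=> *; rewrite add0r.
- by move=> *; rewrite scaleN1r addNr.
- by move=> *; rewrite scalerA.
- by move=> *; rewrite scale1r.
- by move=> *; rewrite scalerDr.
- by move=> *; rewrite scalerDl.
- by move=> n m p a g g' f; rewrite (pcomp_linear_l (teval f)).
- by move=> n m p a g f f'; rewrite (pcomp_linear_r (teval g)).
- by move=> *; rewrite pcompA.
- by move=> *; rewrite pcomp1l.
- by move=> *; rewrite pcomp1r.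
- by move=> n m n' m' a f g f'; rewrite (ptens_linear_l (teval f')).
- by move=> n m n' m' a f f' g'; rewrite (ptens_linear_r (teval f)).
- by move=> *; rewrite ptens1.
- by move=> *; rewrite ptens_comp.
- by move=> *; rewrite teval_hcast ptensA.
- by move=> *; rewrite ptens0l.
- by move=> *; rewrite teval_hcast ptens0r.
- by move=> *; rewrite pperm1.
- by move=> *; rewrite ppermM.
- by move=> *; rewrite pperm_tens.
- by move=> *; rewrite teval_hcast pperm_swap.
Qed.

Definition free_lift_fun n m (q : free_prop n m) : P n m := teval (trepr q).

Lemma free_lift_funE n m (x : term n m) : free_lift_fun (tcls x) = teval x.
Proof. exact/teval_teq/trepr_cls. Qed.

Definition free_lift : prop_mor free_prop P.
Proof.
exists free_lift_fun.
- move=> n m a p q; have [[{}p ->] [{}q ->]] := conj (free_homP p) (free_homP q).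
  by rewrite tclsP !free_lift_funE.
- by move=> n; apply: free_lift_funE.
- move=> n m p g f; have [[{}f ->] [{}g ->]] := conj (free_homP f) (free_homP g).
  by rewrite [_ \oP _]free_compE !free_lift_funE.
- move=> n m n' m' g f; have [[{}f ->] [{}g ->]] := conj (free_homP f) (free_homP g).
  by rewrite [_ \xP _]free_tensE !free_lift_funE.
- by move=> n s; apply: free_lift_funE.
Defined.

Lemma free_liftE g : free_lift _ _ (free_gen g) = img g.
Proof. exact: free_lift_funE. Qed.

Lemma free_lift_uniq (F : prop_mor free_prop P) :
  (forall g, F _ _ (free_gen g) = img g) -> mor_eq F free_lift.
Proof.
move=> Fg n m q; have [x ->] := free_homP q; rewrite [RHS]free_lift_funE.
elim: x => {n m q} //=.
- by move=> n; apply: (mor_id F).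
- by move=> n s; apply: (mor_perm F).
- move=> n m p g IHg f IHf.
  by rewrite -IHg -IHf -(mor_comp F); congr (F _ _ _); apply/esym/free_compE.
- move=> n m n' m' g IHg f IHf.
  by rewrite -IHg -IHf -(mor_tens F); congr (F _ _ _); apply/esym/free_tensE.
- by move=> n m; apply: (raddf0 (F n m)).
- move=> n m x <- y <-; rewrite -(raddfD (F n m)).
  by congr (F _ _ _); apply/esym/free_addE.
- move=> n m a x <-; rewrite -(linearZ_LR (F n m)).
  by congr (F _ _ _); apply/esym/free_scaleE.
Qed.

End FreeLift.

End FreeProp.

Section SeriesProp.
Variables (K : comNzRingType) (P : propOver K).

Definition series_hom n m : lmodType (fps K) := series (P n m).

Definition series_comp n m p (g : series_hom m p) (f : series_hom n m) :
  series_hom n p := conv (@pcomp K P n m p) g f.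
Definition series_tens n m n' m' (f : series_hom n m) (f' : series_hom n' m') :
  series_hom (n + n') (m + m') := conv (@ptens K P n m n' m') f f'.

Lemma series_hcast n m n' m' (en : n = n') (em : m = m') (x : series_hom n m) :
  hcast (T := series_hom) en em x
  = (fun i => hcast (T := fun i j => P i j) en em (x i)) :> (nat -> P n' m').
Proof. by case: _ / en; case: _ / em. Qed.

Lemma conv_linear_l (U V W : lmodType K) (b : U -> V -> W) : biadditive b ->
  (forall a x y, b (a *: x) y = a *: b x y) ->
  forall v : series V, linear (fun u : series U => conv b u v : series W).
Proof.
move=> hb hZ v a u u'; rewrite (convDl hb); congr (_ + _).
by apply: conv_assoc => //; apply: scale_biadd.
Qed.

Lemma conv_linear_r (U V W : lmodType K) (b : U -> V -> W) : biadditive b ->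
  (forall a x y, b x (a *: y) = a *: b x y) ->
  forall u : series U, linear (fun v : series V => conv b u v : series W).
Proof.
move=> hb hZ u a v v'; rewrite !(conv_flip b u).
by apply: conv_linear_l => //; case: hb.
Qed.

Lemma conv_hcast n m n' m' (en : n = n') (em : m = m') (U V : zmodType)
    (b : U -> V -> P n m) u v i :
  hcast (T := fun i j => P i j) en em (conv b u v i)
  = conv (fun x y => hcast (T := fun i j => P i j) en em (b x y)) u v i.
Proof. by case: _ / en; case: _ / em. Qed.

Lemma hcast_biadd n m n' m' (en : n = n') (em : m = m') (U V : zmodType)
    (b : U -> V -> P n m) : biadditive b ->
  biadditive (fun x y => hcast (T := fun i j => P i j) en em (b x y)).
Proof. by case: _ / en; case: _ / em. Qed.

Let hc := pcomp_biadd P.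
Let ht := ptens_biadd P.

Definition series_prop : propOver (fps K).
Proof.
exists series_hom (fun n => const_ser (pid P n)) series_comp series_tens
  (fun n s => const_ser (pperm P s)).
- by move=> n m p f; apply: conv_linear_l => // *; apply: pcompZl.
- by move=> n m p g; apply: conv_linear_r => // *; apply: pcompZr.
- by move=> n m p q h g f; apply: conv_assoc => // *; apply: pcompA.
- move=> n m f; rewrite /series_comp conv_constl //.
  by apply/funext => i; apply: pcomp1l.
- move=> n m f; rewrite /series_comp conv_constr //.
  by apply/funext => i; apply: pcomp1r.
- by move=> n m n' m' f; apply: conv_linear_l => // *; apply: ptensZl.
- by move=> n m n' m' f; apply: conv_linear_r => // *; apply: ptensZr.
- by move=> n n'; rewrite /series_tens conv_consts // ptens1.
- by move=> n m p n' m' p' g f g' f'; apply: conv_interchange => // *; apply: ptens_comp.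
- move=> n m n' m' n'' m'' f g h; rewrite series_hcast.
  transitivity (conv (fun x y => hcast (T := fun i j => P i j)
     (addnA n n' n'') (addnA m m' m'') (ptens x y)) f (series_tens g h)).
    by apply/funext => i; apply: conv_hcast.
  apply/esym/conv_assoc => //; first exact: hcast_biadd.
  by move=> x y z; rewrite ptensA.
- move=> n m f; rewrite /series_tens conv_constl //.
  by apply/funext => i; apply: ptens0l.
- move=> n m f; rewrite series_hcast /series_tens conv_constr //.
  by apply/funext => i; apply: ptens0r.
- by move=> n; rewrite pperm1.
- by move=> n s t; rewrite /series_comp conv_consts // ppermM.
- by move=> n n' s t; rewrite /series_tens conv_consts // pperm_tens.
- move=> n m n' m' f f'; rewrite /series_comp conv_constl // conv_constr //.
  apply/funext => i; rewrite series_hcast conv_hcast.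
  rewrite [series_tens _ _]conv_flip.
  rewrite /conv biadd_sumr // biadd_suml //; apply: eq_bigr => k _.
  by rewrite pperm_swap.
Defined.

Definition series_const n m (x : P n m) : series_prop n m := const_ser x.

End SeriesProp.

Section RestrictProp.
Variables (R S : comNzRingType) (phi : {rmorphism R -> S}).

Definition restr_prop (P : propOver S) : propOver R.
Proof.
exists (fun n m => restr_mod phi (P n m)) (pid P) (@pcomp S P) (@ptens S P) (@pperm S P).
- by move=> n m p f a; apply: pcomp_linear_l.
- by move=> n m p g a; apply: pcomp_linear_r.
- exact: pcompA.
- exact: pcomp1l.
- exact: pcomp1r.
- by move=> n m n' m' f a; apply: ptens_linear_l.
- by move=> n m n' m' f a; apply: ptens_linear_r.
- exact: ptens1.
- exact: ptens_comp.
- exact: (@ptensA S P).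
- exact: ptens0l.
- exact: (@ptens0r S P).
- exact: pperm1.
- exact: ppermM.
- exact: pperm_tens.
- exact: (@pperm_swap S P).
Defined.

Definition restr_mor (P P' : propOver S) (F : prop_mor P P') :
  prop_mor (restr_prop P) (restr_prop P').
Proof.
refine (@PropMor R (restr_prop P) (restr_prop P') (fun n m (x : P n m) => F n m x) _ _ _ _ _).
- by move=> n m a; apply: (mor_linear F).
- exact: (mor_id F).
- exact: (mor_comp F).
- exact: (mor_tens F).
- exact: (mor_perm F).
Defined.

End RestrictProp.

Section ModH.
Variable K : comNzRingType.
Local Notation S := (fps K).

Section Def.
Variable P : propOver S.
Local Notation rP := (restr_prop (@fps_const K) P).

Definition hmult n m (x : P n m) : Prop := exists y : P n m, x = hvar K *: y.

Definition hmult_submod n m : submod (rP n m).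
Proof.
exists (@hmult n m : rP n m -> Prop); first by exists 0; rewrite scaler0.
move=> a _ _ [x ->] [y ->]; exists (fps_const a *: x + y).
by rewrite scalerDr [in RHS]scalerA mulrC -scalerA.
Defined.

Definition hideal : prop_ideal rP.
Proof.
exists hmult_submod => [n m p g _ [f ->]|n m p _ f [g ->]|n m n' m' _ f' [f ->]
  |n m n' m' f _ [f' ->]].
- by exists (g \oP f : P _ _); apply: (pcompZr (P := P)).
- by exists (g \oP f : P _ _); apply: (pcompZl (P := P)).
- by exists (f \xP f' : P _ _); apply: (ptensZl (P := P)).
- by exists (f \xP f' : P _ _); apply: (ptensZr (P := P)).
Defined.

(* P / (h), as a prop over K: the quotient is taken after restriction of scalars
   along K -> K[[h]]. *)
Definition modh : propOver K := quot_prop hideal.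

Definition modh_proj : prop_mor rP modh := quot_proj hideal.

Lemma modh_projD n m (x y : P n m) :
  modh_proj n m (x + y) = modh_proj n m x + modh_proj n m y.
Proof. exact: clsD. Qed.

Lemma modh_proj_hmult n m (x : P n m) : modh_proj n m (hvar K *: x) = 0.
Proof. by apply/cls_eq0; exists x. Qed.

Lemma modh_proj_eq0 n m (x : P n m) :
  modh_proj n m x = 0 <-> exists y : P n m, x = hvar K *: y.
Proof. exact: cls_eq0. Qed.

End Def.

Definition modh_mor (P P' : propOver S) (F : prop_mor P P') :
  prop_mor (modh P) (modh P').
Proof.
apply: (@quot_prop_lift _ _ _ _ (compmor (modh_proj P') (restr_mor (@fps_const K) F))).
move=> n m x [y ->] /=.
by rewrite (morZ F); apply: modh_proj_hmult.
Defined.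

Lemma modh_morE (P P' : propOver S) (F : prop_mor P P') n m (x : P n m) :
  modh_mor F n m (modh_proj P n m x) = modh_proj P' n m (F n m x).
Proof. exact: quot_prop_liftE. Qed.

Definition coef0_mor (P : propOver K) :
  prop_mor (restr_prop (@fps_const K) (series_prop P)) P.
Proof.
exists (fun n m x => (x : nat -> P n m) 0%N).
- move=> n m a x y; rewrite [LHS]/GRing.add /=; congr (_ + _).
  exact: (congr1 (fun u : nat -> P n m => u 0%N) (conv_constl a x (scale_biadd _))).
- by [].
- by move=> n m p g f; rewrite /= /series_comp /conv big_ord1.
- by move=> n m n' m' f f'; rewrite /= /series_tens /conv big_ord1.
- by [].
Defined.

(* The identification of P[[h]] / (h) with P; bijective by modh_series_inj and
   modh_series_surj. *)
Definition modh_series (P : propOver K) : prop_mor (modh (series_prop P)) P.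
Proof.
apply: (@quot_prop_lift _ _ _ _ (coef0_mor P)) => n m x [y ->] /=.
by rewrite /GRing.scale /= /series_scale /conv big_ord1 scale0r.
Defined.

Lemma modh_seriesE (P : propOver K) n m (x : series_prop P n m) :
  modh_series P n m (modh_proj _ n m x) = (x : nat -> P n m) 0%N.
Proof. exact: quot_prop_liftE. Qed.

Lemma coef0_hmult (P : propOver K) n m (x : series_prop P n m) :
  (x : nat -> P n m) 0%N = 0 -> hmult x.
Proof.
move=> x0; exists (fun i => (x : nat -> P n m) i.+1).
apply/funext => -[|i].
  by rewrite /GRing.scale /= /series_scale /conv big_ord1 scale0r x0.
rewrite /GRing.scale /= /series_scale /conv 2!big_ord_recl /= scale0r add0r.
rewrite scale1r big1 ?addr0 ?subn1 //= => j _.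
by rewrite scale0r.
Qed.

Lemma modh_series_inj (P : propOver K) n m : injective (modh_series P n m).
Proof.
move=> p q; have [x ->] := quot_homP p; have [y ->] := quot_homP q => e.
have {}e : (x : nat -> P n m) 0%N = (y : nat -> P n m) 0%N.
  by rewrite -!modh_seriesE.
apply/cls_eq/(@coef0_hmult P n m (x - y)).
by rewrite [LHS]/GRing.add /= [X in _ + X]/GRing.opp /= e subrr.
Qed.

Lemma modh_series_surj (P : propOver K) n m (x : P n m) :
  exists q, modh_series P n m q = x.
Proof.
by exists (modh_proj _ n m (series_const x)); apply: modh_seriesE.
Qed.

End ModH.

(* The permutation (i_1 ... i_k), sending a to i_a, for s = [:: i_1; ..; i_k];
   indices in s start from 1, those of 'I_k from 0. *)
Definition place_perm k (s : seq nat) : 'S_k :=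
  odflt 1%g [pick t : 'S_k | [forall a, (t a).+1 == nth 0%N s a]].

Lemma place_permE k (s : seq nat) : perm_eq s (iota 1 k) ->
  forall a : 'I_k, (place_perm k s a).+1 = nth 0%N s a.
Proof.
move=> sk; have szs : size s = k by rewrite (perm_size sk) size_iota.
have us : uniq s by rewrite (perm_uniq sk) iota_uniq.
have rg (a : 'I_k) : (0 < nth 0%N s a <= k)%N.
  have : nth 0%N s a \in s by rewrite mem_nth // szs.
  by rewrite (perm_mem sk) mem_iota add1n ltnS.
pose f (a : 'I_k) : 'I_k := insubd a (nth 0%N s a).-1.
have val_f a : (f a).+1 = nth 0%N s a.
  have /andP[gt0 lek] := rg a.
  by rewrite val_insubd prednK // lek prednK.
have inj_f : injective f.
  move=> a b /(congr1 (fun i : 'I_k => i.+1)).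
  by rewrite !val_f => /eqP; rewrite nth_uniq ?szs // => /eqP/val_inj.
rewrite /place_perm; case: pickP => [t /forallP ta a | none]; first exact/eqP.
have /negP[] := negbT (none (perm inj_f)).
by apply/forallP => a; rewrite permE val_f.
Qed.

Section YangBaxter.
Variables (R : comNzRingType) (P : propOver R).
Variables (eta : P 0%N 1%N) (mul : P 2%N 1%N) (r : P 0%N 2%N).

Local Notation id1 := (pid P 1).

Definition unit_l : P 1%N 1%N := mul \oP (eta \xP id1 : P 1%N 2%N) - id1.
Definition unit_r : P 1%N 1%N := mul \oP (id1 \xP eta : P 1%N 2%N) - id1.
Definition assoc : P 3%N 1%N :=
  mul \oP (mul \xP id1 : P 3%N 2%N) - mul \oP (id1 \xP mul : P 3%N 2%N).

Definition bracket : P 2%N 1%N := mul - mul \oP pperm P (place_perm 2 [:: 2; 1]).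

(* r^{I1} r^{I2} and r^{I1} r^{I2} r^{I3}, for s the concatenation of the I's. *)
Definition rr (s : seq nat) : P 0%N 4%N :=
  pperm P (place_perm 4 s) \oP (r \xP r : P 0%N 4%N).
Definition rrr (s : seq nat) : P 0%N 6%N :=
  pperm P (place_perm 6 s) \oP (r \xP r \xP r : P 0%N 6%N).

Definition classical_yb : P 0%N 3%N :=
    (bracket \xP id1 \xP id1 : P 4%N 3%N) \oP rr [:: 1; 3; 2; 4]
  + (id1 \xP bracket \xP id1 : P 4%N 3%N) \oP rr [:: 1; 2; 3; 4]
  + (id1 \xP id1 \xP bracket : P 4%N 3%N) \oP rr [:: 1; 3; 2; 4].

Definition cubic_yb : P 0%N 3%N :=
  (mul \xP mul \xP mul : P 6%N 3%N)
    \oP (rrr [:: 1; 3; 2; 5; 4; 6] - rrr [:: 3; 5; 1; 6; 2; 4]).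

End YangBaxter.

Section YangBaxterMor.
Variables (R : comNzRingType) (P P' : propOver R) (F : prop_mor P P').
Variables (eta : P 0%N 1%N) (mul : P 2%N 1%N) (r : P 0%N 2%N).
Local Notation F' := (F _ _).

Let id1E : F _ _ (pid P 1) = pid P' 1 := mor_id F 1.

Lemma mor_unit_l : F' (unit_l eta mul) = unit_l (F' eta) (F' mul).
Proof.
have e : F 1%N 2%N (eta \xP pid P 1) = _ := mor_tens F eta (pid P 1).
by rewrite linearB /= mor_comp e id1E.
Qed.

Lemma mor_unit_r : F' (unit_r eta mul) = unit_r (F' eta) (F' mul).
Proof.
have e : F 1%N 2%N (pid P 1 \xP eta) = _ := mor_tens F (pid P 1) eta.
by rewrite linearB /= mor_comp e id1E.
Qed.

Lemma mor_assoc : F' (assoc mul) = assoc (F' mul).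
Proof.
have e : F 3%N 2%N (mul \xP pid P 1) = _ := mor_tens F mul (pid P 1).
have e' : F 3%N 2%N (pid P 1 \xP mul) = _ := mor_tens F (pid P 1) mul.
by rewrite linearB /= !mor_comp e e' id1E.
Qed.

Lemma mor_bracket : F' (bracket mul) = bracket (F' mul).
Proof. by rewrite linearB /= mor_comp mor_perm. Qed.

Lemma mor_rr s : F' (rr r s) = rr (F' r) s.
Proof.
have e : F 0%N 4%N (r \xP r) = _ := mor_tens F r r.
by rewrite mor_comp mor_perm e.
Qed.

Lemma mor_classical_yb : F' (classical_yb mul r) = classical_yb (F' mul) (F' r).
Proof.
have e n m n' m' n'' m'' (f : P n m) (g : P n' m') (h : P n'' m'') :
    F _ _ (f \xP g \xP h) = F _ _ f \xP F _ _ g \xP F _ _ h.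
  by rewrite !mor_tens.
have e1 : F 4%N 3%N (bracket mul \xP pid P 1 \xP pid P 1) = _ :=
  e _ _ _ _ _ _ (bracket mul) (pid P 1) (pid P 1).
have e2 : F 4%N 3%N (pid P 1 \xP bracket mul \xP pid P 1) = _ :=
  e _ _ _ _ _ _ (pid P 1) (bracket mul) (pid P 1).
have e3 : F 4%N 3%N (pid P 1 \xP pid P 1 \xP bracket mul) = _ :=
  e _ _ _ _ _ _ (pid P 1) (pid P 1) (bracket mul).
rewrite !linearD /= ![F 0%N 3%N _]mor_comp !mor_rr e1 e2 e3 mor_bracket.
by rewrite !id1E.
Qed.

End YangBaxterMor.

Inductive yb_gen := gen_eta | gen_mul | gen_r.

Definition yb_src (g : yb_gen) : nat :=
  match g with gen_eta => 0 | gen_mul => 2 | gen_r => 0 end.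
Definition yb_tgt (g : yb_gen) : nat :=
  match g with gen_eta => 1 | gen_mul => 1 | gen_r => 2 end.

Section YBProps.
Variable K : comNzRingType.

Definition YBFree : propOver K := free_prop K yb_src yb_tgt.
Definition free_eta : YBFree 0%N 1%N := free_gen K yb_src yb_tgt gen_eta.
Definition free_mul : YBFree 2%N 1%N := free_gen K yb_src yb_tgt gen_mul.
Definition free_r : YBFree 0%N 2%N := free_gen K yb_src yb_tgt gen_r.

Inductive CYBA_rel : forall n m, YBFree n m -> Prop :=
| CYBA_unit_l : CYBA_rel (unit_l free_eta free_mul)
| CYBA_unit_r : CYBA_rel (unit_r free_eta free_mul)
| CYBA_assoc : CYBA_rel (assoc free_mul)
| CYBA_yb : CYBA_rel (classical_yb free_mul free_r).

Definition CYBA : propOver K := quot_prop (gen_ideal CYBA_rel).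

(* In the category of quotients of topologically free K[[h]]-modules by closed
   submodules, the free prop over K[[h]] on some generators is F[[h]], for F the
   free prop over K on the same generators. *)
Definition QYBFree : propOver (fps K) := series_prop YBFree.
Definition qfree_eta : QYBFree 0%N 1%N := series_const free_eta.
Definition qfree_mul : QYBFree 2%N 1%N := series_const free_mul.
Definition qfree_rho : QYBFree 0%N 2%N := series_const free_r.

Inductive QYBA_rel : forall n m, QYBFree n m -> Prop :=
| QYBA_unit_l : QYBA_rel (unit_l qfree_eta qfree_mul)
| QYBA_unit_r : QYBA_rel (unit_r qfree_eta qfree_mul)
| QYBA_assoc : QYBA_rel (assoc qfree_mul)
| QYBA_yb : QYBA_rel (classical_yb qfree_mul qfree_rho
                      + hvar K *: cubic_yb qfree_mul qfree_rho).

Definition QYBA : propOver (fps K) := quot_prop (closed_gen_ideal QYBA_rel).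

Definition qyba_cls n m (x : QYBFree n m) : modh QYBA n m :=
  modh_proj QYBA n m (quot_proj (closed_gen_ideal QYBA_rel) n m x).

(* rho is the generator gen_r, seen as a constant series in QYBFree. *)
Definition SC_gen (g : yb_gen) : modh QYBA (yb_src g) (yb_tgt g) :=
  qyba_cls (series_const (free_gen K yb_src yb_tgt g)).

Lemma SC_gen_rel n m (x : YBFree n m) :
  CYBA_rel x -> free_lift SC_gen n m x = 0.
Proof.
pose F := free_lift SC_gen.
have Feta : F _ _ free_eta = qyba_cls qfree_eta := free_liftE SC_gen gen_eta.
have Fmul : F _ _ free_mul = qyba_cls qfree_mul := free_liftE SC_gen gen_mul.
have Fr : F _ _ free_r = qyba_cls qfree_rho := free_liftE SC_gen gen_r.
pose c : prop_mor (restr_prop (@fps_const K) QYBFree) (modh QYBA) :=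
  compmor (modh_proj QYBA)
    (restr_mor (@fps_const K) (quot_proj (closed_gen_ideal QYBA_rel))).
have cE i j (y : QYBFree i j) : qyba_cls y = c i j y by [].
have c0 i j (y : QYBFree i j) : QYBA_rel y -> c i j y = 0.
  move=> /gen_ideal_contains /cls_eq0 y0.
  rewrite -cE /qyba_cls [quot_proj _ _ _ _]y0.
  exact: (raddf0 (modh_proj QYBA i j)).
case=> {n m x}; rewrite -/F.
- rewrite mor_unit_l Feta Fmul !cE -(mor_unit_l c); exact/c0/QYBA_unit_l.
- rewrite mor_unit_r Feta Fmul !cE -(mor_unit_r c); exact/c0/QYBA_unit_r.
- rewrite mor_assoc Fmul !cE -(mor_assoc c); exact/c0/QYBA_assoc.
- rewrite mor_classical_yb Fmul Fr !cE -(mor_classical_yb c).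
  set x := classical_yb _ _; pose y := hvar K *: cubic_yb qfree_mul qfree_rho.
  have y0 : c _ _ y = 0.
    rewrite -cE /qyba_cls /y morZ.
    exact: modh_proj_hmult.
  have := c0 _ _ _ QYBA_yb.
  by rewrite (morD c x y) y0 addr0.
Qed.

Definition SC : prop_mor CYBA (modh QYBA) :=
  quot_prop_lift (gen_ideal_ker SC_gen_rel).

Lemma SCE g : SC _ _ (quot_proj (gen_ideal CYBA_rel) _ _ (free_gen K yb_src yb_tgt g))
  = SC_gen g.
Proof. by rewrite [LHS]quot_prop_liftE free_liftE. Qed.

End YBProps.

(* Main.v *)
Require Import Defs.
From mathcomp Require Import all_boot all_algebra.
From mathcomp Require Import boolp.

(** Every element of [QYBA / (h)] is the class of a constant series, so [SC] is
    onto; with the hypothesis this makes [Q mod h] bijective.  If [Q q = 0] then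
    [q = h q'], and [Q q' = 0] because the target has no [h]-torsion; hence [q] is
    divisible by every power of [h], so it vanishes, the ideal of relations being
    [h]-adically closed.  For surjectivity a preimage in the free prop is found
    one coefficient at a time. *)

Set Implicit Arguments.
Unset Strict Implicit.
Unset Printing Implicit Defensive.

Import GRing.Theory.
Local Open Scope ring_scope.

Lemma hvar_scale (K : comNzRingType) (V : lmodType K) (x : series V) :
  hvar K *: x = (fun n => if n is k.+1 then x k else 0) :> (nat -> V).
Proof.
apply/funext => -[|i].
  by rewrite /GRing.scale /= /series_scale /conv big_ord1 scale0r.
rewrite /GRing.scale /= /series_scale /conv 2!big_ord_recl /= scale0r add0r.
rewrite scale1r big1 ?addr0 ?subn1 //= => j _.
by rewrite scale0r.
Qed.

Lemma hvar_scale_inj (K : comNzRingType) (V : lmodType K) (x : series V) :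
  hvar K *: x = 0 -> x = 0.
Proof.
rewrite hvar_scale => x0; apply/funext => n.
exact: (congr1 (fun u : nat -> V => u n.+1) x0).
Qed.

Lemma series_split (K : comNzRingType) (V : lmodType K) (x : series V) :
  x = (const_ser (x 0%N) : series V) + hvar K *: ((fun n => x n.+1) : series V).
Proof.
by rewrite hvar_scale; apply/funext => -[|n]; rewrite /GRing.add /= ?addr0 ?add0r.
Qed.

Lemma hvar_scale_tail (K : comNzRingType) (V : lmodType K) (x : series V) :
  x 0%N = 0 -> x = hvar K *: ((fun n => x n.+1) : series V).
Proof. by move=> x0; rewrite hvar_scale; apply/funext => -[|n]. Qed.

(** Makes the class of a constant series a prop morphism in its coefficient, so that
    [free_lift_uniq] applies to it in [SC_cls]. *)
Definition const_mor (K : comNzRingType) (P : propOver K) :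
  prop_mor P (restr_prop (@fps_const K) (series_prop P)).
Proof.
exists (fun n m x => series_const x).
- move=> n m a x y; apply/funext => i; rewrite [RHS]/GRing.add /=.
  transitivity (a *: const_ser x i + const_ser y i).
    by case: i => //= i; rewrite scaler0 addr0.
  congr (_ + _).
  exact/esym/(congr1 (fun u : nat -> P n m => u i)
    (conv_constl a (const_ser x) (scale_biadd (P n m)))).
- by [].
- move=> n m p g f; exact/esym/(conv_consts g f (pcomp_biadd P n m p)).
- move=> n m n' m' f f'; exact/esym/(conv_consts f f' (ptens_biadd P n m n' m')).
- by [].
Defined.

Lemma bijective_prop_iso (R : comNzRingType) (P P' : propOver R) (F : prop_mor P P') :
  (forall n m x, F n m x = 0 -> x = 0) ->
  (forall n m y, exists x, F n m x = y) -> prop_iso F.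
Proof.
move=> F0 Fsurj.
have Finj n m : injective (F n m).
  move=> x y e; apply/eqP; rewrite -subr_eq0; apply/eqP/F0.
  by rewrite morB e subrr.
pose G n m y := sval (cid (Fsurj n m y)).
have FK n m y : F n m (G n m y) = y by exact: svalP (cid (Fsurj n m y)).
(* Each axiom for [G] is checked after applying [F], which is injective. *)
unshelve eexists.
  exists G.
  - by move=> n m a x y; apply: Finj; rewrite mor_linear !FK.
  - by move=> n; apply: Finj; rewrite FK mor_id.
  - by move=> n m p g f; apply: Finj; rewrite mor_comp !FK.
  - by move=> n m n' m' f f'; apply: Finj; rewrite mor_tens !FK.
  - by move=> n s; apply: Finj; rewrite FK mor_perm.
by split=> n m x /=; [apply: Finj; rewrite FK | rewrite FK].
Qed.

(** An intersection of closed ideals is closed: the approximants [y] of [x] lie in every such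
    [J]. *)
Lemma closed_gen_ideal_closed (K : comNzRingType) (P : propOver (fps K))
    (rel : forall n m, P n m -> Prop) : hadic_closed (closed_gen_ideal rel).
Proof.
move=> n m x xI J cJ rJ; apply: (cJ) => N; have [y Iy xy] := xI N.
by exists y => //; apply: Iy.
Qed.

Lemma closed_quot_separated (K : comNzRingType) (P : propOver (fps K))
    (I : prop_ideal P) n m (q : quot_prop I n m) :
  hadic_closed I -> (forall N, exists z, q = hvar K ^+ N *: z) -> q = 0.
Proof.
have [x ->] := quot_homP q => cI div; apply/cls_eq0/cI => N.
have [z] := div N; have [w ->] := quot_homP z; rewrite -linearZ => /cls_eq Iw.
by exists (x - hvar K ^+ N *: w) => //; exists w; rewrite subKr.
Qed.

Lemma ker_divisible (K : comNzRingType) (P : propOver (fps K)) (P' : propOver K)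
    (F : prop_mor P (series_prop P')) n m (x : P n m) N :
  (forall x : P n m, F n m x = 0 -> hmult x) ->
  F n m x = 0 -> exists y : P n m, x = hvar K ^+ N *: y.
Proof.
(* The induction must also keep [y] in the kernel, so that [F0] divides it again. *)
move=> F0 Fx; suff [y -> _] : exists2 y, x = hvar K ^+ N *: y & F n m y = 0.
  by exists y.
elim: N => [|N [y -> Fy]]; first by exists x; rewrite ?expr0 ?scale1r.
have [z yz] := F0 y Fy.
exists z; first by rewrite yz scalerA -exprSr.
by apply: (@hvar_scale_inj K); rewrite -(morZ F) -yz.
Qed.

(* The error [d k] left after [k] coefficients, divided by [h ^ k], satisfies
   [d k = h * d k.+1]. *)
Lemma series_linear_surj (K : comNzRingType) (V W : lmodType K)
    (f : series V -> series W) : linear f ->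
  (forall w, exists v, f (const_ser v : series V) 0%N = w) ->
  forall y, exists x, f x = y.
Proof.
move=> fl /choice[s fs] y.
pose step (u : series W) : series W :=
  fun n => (u - f (const_ser (s (u 0%N)) : series V)) n.+1.
(* Coefficient [n] is the correction chosen at stage [k + n]; dropping the first one turns [x k]
   into [x k.+1]. *)
pose x k : series V := fun n => s (iter (k + n) step y 0%N).
exists (x 0%N); pose d k := iter k step y - f (x k).
have dS k : d k = hvar K *: d k.+1.
  rewrite /d [x k]series_split (linear_add fl) (linear_scale fl) opprD addrA.
  have -> : (fun n => x k n.+1) = x k.+1.
    by apply/funext => n; rewrite /x addnS addSn.
  rewrite scalerBr; congr (_ - _).
  rewrite /x addn0; set u := iter k step y.
  apply: (hvar_scale_tail (x := u - f (const_ser (s (u 0%N)) : series V))).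
  by rewrite /GRing.add /= /GRing.opp /= fs subrr.
apply/esym/eqP; rewrite -subr_eq0; apply/eqP/funext => n.
(* Generalized over [k]: by [dS], coefficient [n.+1] of [d k] is coefficient [n] of [d k.+1]. *)
change (d 0%N n = 0); move: 0%N; elim: n => [|n IHn] k; by rewrite dS hvar_scale.
Qed.

Section SCSurjective.
Variable K : comNzRingType.

(** Both sides are prop morphisms on the free prop that agree on generators. *)
Lemma SC_cls n m (x : YBFree K n m) :
  SC K n m (quot_proj (gen_ideal (@CYBA_rel K)) n m x) = qyba_cls (series_const x).
Proof.
rewrite [LHS]quot_prop_liftE.
pose c := compmor (modh_proj (QYBA K))
  (compmor (restr_mor (@fps_const K) (quot_proj (closed_gen_ideal (@QYBA_rel K))))
           (const_mor (YBFree K))).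
exact/esym/(free_lift_uniq (F := c)).
Qed.

Lemma SC_surj n m (q : modh (QYBA K) n m) : exists c, SC K n m c = q.
Proof.
have [p ->] := quot_homP q; have [x ->] := quot_homP p.
exists (quot_proj (gen_ideal (@CYBA_rel K)) n m ((x : nat -> YBFree K n m) 0%N)).
rewrite SC_cls /qyba_cls; set y : QYBFree K n m := series_const _.
have -> : x = y + hvar K *: ((fun i => (x : nat -> YBFree K n m) i.+1) : QYBFree K n m).
  exact: (@series_split K (YBFree K n m) x).
rewrite -[cls _ (y + _)]/(quot_proj _ n m _) morD morZ.
by rewrite [RHS](@modh_projD K) modh_proj_hmult addr0.
Qed.

End SCSurjective.

Theorem proposition3p1 (K : fieldType) (charK : [pchar K]%R =i pred0)
    (Q : prop_mor (QYBA K) (series_prop (CYBA K))) :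
  mor_eq (compmor (modh_series (CYBA K)) (compmor (modh_mor Q) (SC K)))
         (idmor (CYBA K)) ->
  prop_iso Q.
Proof.
move=> QSC; apply: bijective_prop_iso => n m.
  move=> q Qq; apply: closed_quot_separated => [|N].
    exact: closed_gen_ideal_closed.
  apply: ker_divisible Qq => {}q Qq.
  (* The hypothesis recovers [c] as the constant coefficient of [Q q], which is zero. *)
  apply/modh_proj_eq0; have [c qc] := SC_surj (modh_proj _ n m q).
  have : modh_series (CYBA K) n m (modh_mor Q n m (SC K n m c)) = c by exact: QSC.
  by rewrite -qc {1}qc modh_morE modh_seriesE Qq => <-; rewrite mor0.
move=> y.
(* Passing to [QYBFree] makes the source a module of series, where infinitely many corrections can
   be assembled. *)
pose p := quot_proj (closed_gen_ideal (@QYBA_rel K)).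
have [||x Qx] := @series_linear_surj K (YBFree K n m) (CYBA K n m)
    (compmor Q p n m) _ _ y.
- exact: (@mor_linear _ _ _ (compmor Q p) n m).
- move=> c; have [x ->] := quot_homP c; exists x.
  rewrite -[RHS](QSC n m) -[RHS]/(modh_series _ n m (modh_mor Q n m (SC K n m _))).
  by rewrite SC_cls modh_morE modh_seriesE.
- by exists (p n m x).
Qed.
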